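(* Let $N\ge2$ be an integer and $\rho,\tau,\lambda>0$. For $\beta\in[0,\rho]$ let $$u(\beta)=\frac{(\rho-\beta)\left((N-1)\beta+\rho+\tau\right)}{(N\beta+\tau)\rho^2}-\frac1\rho-\frac1\tau-\frac{\lambda}{(N-1)\beta+\rho+\tau},$$ and let $\beta^*$ denote a maximizer of $u(\beta)$ over $\beta\in[0,\rho]$ subject to $u(\beta)\ge u^0=-\frac{\lambda}{\rho+\tau}=u(0)$. (1) If $\lambda<\frac{(N\rho+\tau)^2}{(N-1)^2\rho^2}$, it is not profitable to collaborate: $\beta^*=0$. (2) If $\lambda>\frac{(N\rho^2+2\rho\tau+\tau^2)(\rho+\tau)^2}{(N-1)\rho^2\tau^2}$, it is always profitable to collaborate: $\beta^*>0$. If also $\lambda<\frac{(N\rho+\tau)^2}{(N-1)\rho^2}$, then $\beta^*$ is the only solution of the equation $\frac{du}{d\beta}=0$ on the interval $[0,\rho]$, and $$\frac{d\beta^*}{d\lambda}\ge0,\qquad\frac{d\beta^*}{d\rho}\ge0.$$ (3) If $\lambda>\frac{(N\rho^2+2\rho\tau+\tau^2)(\rho+\tau)^2}{(N-1)\rho^2\tau^2}$ and $\lambda\ge\frac{(N\rho+\tau)^2}{(N-1)\rho^2}$, collaboration is profitable and moreover nobody adds noise to their messages: $\beta^*=\rho$.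
   Context: Setting (symmetric Bayesian mean estimation). A parameter $\mu\sim N(0,1/\tau)$ is drawn; each of $N$ clients holds $n$ samples i.i.d. $N(\mu,\sigma^2)$ given $\mu$ and reveals its sample mean plus $N(0,\alpha^2)$ noise, with common $\alpha$ and common accuracy weight $\lambda$. Here $\rho=n/\sigma^2$ and $\beta=\frac{1}{1/\rho+\alpha^2}\in[0,\rho]$ ($\beta=0$ is no participation, $\beta=\rho$ is no noise). The utility $u$ is the negative of (squared data-reconstruction leakage plus $\lambda$ times the mean squared error of the best estimate of $\mu$), and $u^0$ is the utility of training alone. Derivatives of $\beta^*$ are partial derivatives with respect to the indicated parameter among $\lambda,\rho$, with the other one and $N,\tau$ fixed. *)

(* Defs.v *)
From Stdlib Require Import Reals Lra Lia Psatz.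
From Coquelicot Require Import Coquelicot.
Open Scope R_scope.

(* Division is total in [R]; for [2 <= N], [0 < rho], [0 < tau] no denominator
   vanishes on [0 <= beta <= rho], nor on a neighbourhood of that interval, so
   the two-sided derivative of [utility] is meaningful at both endpoints. *)
Definition utility (N : nat) (tau rho lam beta : R) : R :=
  (rho - beta) * ((INR N - 1) * beta + rho + tau)
    / ((INR N * beta + tau) * rho ^ 2)
  - 1 / rho - 1 / tau
  - lam / ((INR N - 1) * beta + rho + tau).

Definition utility_alone (tau rho lam : R) : R := - (lam / (rho + tau)).

Definition feasible (N : nat) (tau rho lam beta : R) : Prop :=
  0 <= beta <= rho /\ utility N tau rho lam beta >= utility_alone tau rho lam.

Definition is_maximizer (N : nat) (tau rho lam beta : R) : Prop :=
  feasible N tau rho lam beta /\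
  forall b : R, feasible N tau rho lam b ->
    utility N tau rho lam b <= utility N tau rho lam beta.

Lemma utility_0 (N : nat) (tau rho lam : R) :
  0 < tau -> 0 < rho -> utility N tau rho lam 0 = utility_alone tau rho lam.
Proof. intros ht hr; unfold utility, utility_alone; field; lra. Qed.

(* Maximizers exist for all admissible parameters, so hypotheses of the form
   "[f] selects a maximizer" are satisfiable. *)
Lemma is_maximizer_exists (N : nat) (tau rho lam : R) :
  (2 <= N)%nat -> 0 < tau -> 0 < rho -> exists b, is_maximizer N tau rho lam b.
Proof.
intros hN ht hr.
assert (hNR : 2 <= INR N) by (apply (le_INR 2); exact hN).
destruct (continuity_ab_maj (utility N tau rho lam) 0 rho) as [b [hb hb']].
- lra.
- intros c hc; apply continuity_pt_filterlim.
  apply (ex_derive_continuous (utility N tau rho lam) c).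
  assert (h1 : 0 < INR N * c + tau) by nra.
  assert (h2 : 0 < (INR N - 1) * c + rho + tau) by nra.
  assert (h12 : (INR N * c + tau) * rho ^ 2 <> 0)
    by (apply Rgt_not_eq, Rmult_lt_0_compat; nra).
  unfold utility; auto_derive; repeat apply conj; simpl in *; trivial; lra.
- exists b; split; [split; [exact hb'|]|].
  + rewrite <- (utility_0 N tau rho lam ht hr); apply Rle_ge, hb; lra.
  + intros c [hc _]; apply hb; exact hc.
Qed.

(* Main.v *)
Require Import Defs.
From Stdlib Require Import Reals Lra.
From Coquelicot Require Import Coquelicot.
Open Scope R_scope.

(** Put [B = (N-1) b + rho + tau], [A = N b + tau] and [d = rho - b], so that
    [B = A + d].  Then [u' = (N-1)/B^2 * (lam - h)], where
    [h = B^2 (B^2 + (N-1) d^2) / ((N-1) A^2 rho^2)] takes at [b = 0] and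
    [b = rho] the two thresholds of the theorem.  The sign of [dh/db] is that of
    [g = (N-2) B^3 - 3 (N-1) B^2 d - (N-1)^2 d^3], and [g/B^3] increases with
    [b], because [d/B] decreases; hence [h] is strictly quasiconvex.  If
    [h(0) < lam], then [h] crosses the level [lam] at most once, and upwards;
    this locates the maximizer.  At a crossing [g > 0], and [g >= 0] is exactly
    what makes [dh/drho <= 0], so both signs follow from implicit
    differentiation.  For part (1), [u(b) < u(0)] means that [lam] lies below an
    explicit rational function of [b]; its comparison with the threshold is a
    polynomial inequality with nonnegative coefficients in [N - 2], [b],
    [rho - b] and [tau]. *)

(** * First-order tests at a maximum, and implicit differentiation *)

Lemma is_derive_pos_locally (f : R -> R) (x l : R) :
  is_derive f x l -> 0 < l ->
  exists d : R, 0 < d /\ forall t : R, Rabs (t - x) < d ->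
    (x < t -> f x < f t) /\ (t < x -> f t < f x).
Proof.
intros hf hl.
apply is_derive_Reals in hf.
destruct (hf (l / 2)) as [d hd]; [lra|].
exists d; split; [apply cond_pos|].
assert (key : forall t, Rabs (t - x) < d -> t <> x ->
                0 < (f t - f x) / (t - x)).
{ intros t ht hne.
  specialize (hd (t - x) ltac:(lra) ht).
  replace (x + (t - x)) with t in hd by ring.
  apply Rabs_def2 in hd; lra. }
intros t ht; split; intros hlt; specialize (key t ht ltac:(lra)).
- apply (Rmult_lt_compat_r (t - x)) in key; [|lra].
  replace ((f t - f x) / (t - x) * (t - x)) with (f t - f x) in key
    by (field; lra).
  lra.
- apply (Rmult_lt_compat_r (x - t)) in key; [|lra].
  replace ((f t - f x) / (t - x) * (x - t)) with (f x - f t) in key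
    by (field; lra).
  lra.
Qed.

(** If [m < b], points slightly to the right of [m] would give a larger value. *)
Lemma argmax_derive_pos (f : R -> R) (a b m l : R) :
  a <= m <= b -> (forall x, a <= x <= b -> f x <= f m) ->
  is_derive f m l -> 0 < l -> m = b.
Proof.
intros hm hmax hf hl.
destruct (is_derive_pos_locally f m l hf hl) as [d [hd hloc]].
destruct (Req_dec m b) as [|hne]; [assumption|exfalso].
pose (t := m + Rmin (d / 2) (b - m)).
assert (h1 := Rmin_l (d / 2) (b - m)).
assert (h2 := Rmin_r (d / 2) (b - m)).
assert (h3 : 0 < Rmin (d / 2) (b - m)) by (apply Rmin_pos; lra).
assert (ht : Rabs (t - m) < d) by (apply Rabs_def1; unfold t; lra).
assert (h4 : f m < f t) by (apply (hloc t ht); unfold t; lra).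
assert (h5 : f t <= f m) by (apply hmax; unfold t; lra).
lra.
Qed.

Lemma argmax_derive_neg (f : R -> R) (a b m l : R) :
  a <= m <= b -> (forall x, a <= x <= b -> f x <= f m) ->
  is_derive f m l -> l < 0 -> m = a.
Proof.
intros hm hmax hf hl.
enough (- m = - a) by lra.
apply (argmax_derive_pos (fun x => f (- x)) (- b) (- a) (- m) (- l)).
- lra.
- intros x hx; rewrite Ropp_involutive; apply hmax; lra.
- replace (- l) with (scal (-1) l) by (unfold scal; simpl; unfold mult; simpl; ring).
  apply (is_derive_comp f (fun x => - x)).
  + rewrite Ropp_involutive; exact hf.
  + auto_derive; [trivial|ring].
- lra.
Qed.

(* The sign hypothesis lets [y] be compared with the lines of slope
   [- Ht / Hy +- eps] through [(t0, y t0)], so neither continuity of [y] nor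
   joint differentiability of [H] is needed. *)
Lemma is_derive_implicit (H : R -> R -> R) (y : R -> R) (t0 Ht Hy : R) :
  0 < Hy -> H t0 (y t0) = 0 ->
  (forall s, is_derive (fun t => H t (y t0 + s * (t - t0))) t0 (Ht + s * Hy)) ->
  (exists d, 0 < d /\ forall t z, Rabs (t - t0) < d -> Rabs (z - y t0) < d ->
     (z < y t -> H t z < 0) /\ (y t < z -> 0 < H t z)) ->
  is_derive y t0 (- Ht / Hy).
Proof.
intros hHy H0 Hline [d [hd hsign]].
apply is_derive_Reals; intros eps heps.
set (s := - Ht / Hy).
assert (hs : Ht + s * Hy = 0) by (unfold s; field; lra).
(* By [hs], the derivative of [H] along the line of slope [s + eps / 2] is [Hy * eps / 2 > 0]; along
   slope [s - eps / 2] it is the opposite. *)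
destruct (is_derive_pos_locally _ _ _ (Hline (s + eps / 2))) as [d1 [hd1 h1]].
{ nra. }
assert (Hneg : is_derive (fun t => - H t (y t0 + (s - eps / 2) * (t - t0))) t0
                 (- (Ht + (s - eps / 2) * Hy)))
  by apply (is_derive_opp _ _ _ (Hline (s - eps / 2))).
destruct (is_derive_pos_locally _ _ _ Hneg) as [d2 [hd2 h2]].
{ nra. }
(* [K] bounds both slopes, so for [Rabs e < d / K] both lines stay within [d] of [y t0]; [K > 1]
   gives [Rabs e < d] as well. *)
set (K := Rabs s + eps + 1).
assert (hK : 1 < K) by (unfold K; generalize (Rabs_pos s); lra).
assert (hdK : 0 < d / K) by (apply Rdiv_lt_0_compat; lra).
assert (hdl : 0 < Rmin (d / K) (Rmin d1 d2)) by (repeat apply Rmin_pos; assumption).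
exists (mkposreal _ hdl); simpl; intros e he hlt.
assert (e1 : Rabs e < d1).
{ eapply Rlt_le_trans; [exact hlt|].
  eapply Rle_trans; [apply Rmin_r|apply Rmin_l]. }
assert (e2 : Rabs e < d2).
{ eapply Rlt_le_trans; [exact hlt|].
  eapply Rle_trans; [apply Rmin_r|apply Rmin_r]. }
assert (e3 : K * Rabs e < d).
{ assert (h : Rabs e < d / K) by (eapply Rlt_le_trans; [exact hlt|apply Rmin_l]).
  apply (Rmult_lt_compat_l K) in h; [|lra].
  replace (K * (d / K)) with d in h by (field; lra); exact h. }
assert (e4 : Rabs e < d) by (generalize (Rabs_pos e); nra).
assert (hee : t0 + e - t0 = e) by ring.
assert (near : forall k, Rabs k <= K ->
                 Rabs (y t0 + k * e - y t0) < d).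
{ intros k hk; replace (y t0 + k * e - y t0) with (k * e) by ring.
  rewrite Rabs_mult; generalize (Rabs_pos e); nra. }
assert (kp : Rabs (s + eps / 2) <= K).
{ unfold K; eapply Rle_trans; [apply Rabs_triang|].
  rewrite (Rabs_pos_eq (eps / 2)); lra. }
assert (km : Rabs (s - eps / 2) <= K).
{ unfold K; eapply Rle_trans; [apply Rabs_triang|].
  rewrite Rabs_Ropp, (Rabs_pos_eq (eps / 2)); lra. }
specialize (h1 (t0 + e)); specialize (h2 (t0 + e)).
rewrite hee in h1, h2.
replace (t0 - t0) with 0 in h1, h2 by ring.
rewrite !Rmult_0_r, !Rplus_0_r, H0 in h1, h2.
specialize (h1 e1); specialize (h2 e2).
assert (sp := hsign (t0 + e) _ ltac:(rewrite hee; exact e4) (near _ kp)).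
assert (sm := hsign (t0 + e) _ ltac:(rewrite hee; exact e4) (near _ km)).
set (zp := y t0 + (s + eps / 2) * e) in *.
set (zm := y t0 + (s - eps / 2) * e) in *.
replace ((y (t0 + e) - y t0) / e - s) with ((y (t0 + e) - y t0 - s * e) / e)
  by (field; exact he).
unfold Rdiv; rewrite Rabs_mult, Rabs_inv.
apply (Rmult_lt_reg_r (Rabs e)); [apply Rabs_pos_lt; exact he|].
rewrite Rmult_assoc, Rinv_l, Rmult_1_r by (apply Rabs_no_R0; exact he).
(* The signs of [H] on the two lines trap [y (t0 + e)] between [zm] and [zp], whose order depends on
   the sign of [e]. *)
destruct (Rlt_dec 0 e) as [hp|hp].
- rewrite (Rabs_pos_eq e) by lra.
  assert (a1 : y (t0 + e) <= zp).
  { apply Rnot_lt_le; intros c; apply (proj1 sp) in c.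
    generalize (proj1 h1 ltac:(lra)); lra. }
  assert (a2 : zm <= y (t0 + e)).
  { apply Rnot_lt_le; intros c; apply (proj2 sm) in c.
    generalize (proj1 h2 ltac:(lra)); lra. }
  unfold zp, zm in *; apply Rabs_def1; nra.
- rewrite (Rabs_left e) by lra.
  assert (a1 : zp <= y (t0 + e)).
  { apply Rnot_lt_le; intros c; apply (proj2 sp) in c.
    generalize (proj2 h1 ltac:(lra)); lra. }
  assert (a2 : y (t0 + e) <= zm).
  { apply Rnot_lt_le; intros c; apply (proj1 sm) in c.
    generalize (proj2 h2 ltac:(lra)); lra. }
  unfold zp, zm in *; apply Rabs_def1; nra.
Qed.

(** * The critical weight and its partial derivatives *)

(** The function [h] above: the accuracy weight that makes [b] a stationary point of the utility. *)
Definition critical_weight (n tau r b : R) : R :=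
  ((n - 1) * b + r + tau) ^ 2
    * (((n - 1) * b + r + tau) ^ 2 + (n - 1) * (r - b) ^ 2)
    / ((n - 1) * (n * b + tau) ^ 2 * r ^ 2).

(** The cubic [g] above. *)
Definition critical_slope (n tau r b : R) : R :=
  (n - 2) * ((n - 1) * b + r + tau) ^ 3
  - 3 * (n - 1) * ((n - 1) * b + r + tau) ^ 2 * (r - b)
  - (n - 1) ^ 2 * (r - b) ^ 3.

Definition critical_weight_db (n tau r b : R) : R :=
  2 * ((n - 1) * b + r + tau) * critical_slope n tau r b
    / ((n - 1) * (n * b + tau) ^ 3 * r ^ 2).

Definition critical_weight_dr (n tau r b : R) : R :=
  2 * ((n - 1) * b + r + tau)
    * (r * ((n - 1) * b + r + tau) * ((n - 1) * b + r + tau + (n - 1) * (r - b))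
       - ((n - 1) * b + tau)
         * (((n - 1) * b + r + tau) ^ 2 + (n - 1) * (r - b) ^ 2))
    / ((n - 1) * (n * b + tau) ^ 2 * r ^ 3).

Lemma is_derive_utility (N : nat) (tau r lam b : R) :
  2 <= INR N -> 0 < tau -> 0 < r -> 0 <= b ->
  is_derive (utility N tau r lam) b
    ((INR N - 1) / ((INR N - 1) * b + r + tau) ^ 2
     * (lam - critical_weight (INR N) tau r b)).
Proof.
intros hN ht hr hb; unfold utility, critical_weight.
set (n := INR N) in *.
assert (hA : 0 < n * b + tau) by nra.
assert (hB : 0 < (n - 1) * b + r + tau) by nra.
auto_derive.
- repeat split; try lra.
  apply Rgt_not_eq; apply Rmult_lt_0_compat; nra.
- field; repeat split; lra.
Qed.

(** One computation along the direction [(p, s)] serves several ends: the partial derivative in [b],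
    the lines required by [is_derive_implicit], and continuity along the diagonal [b = r]. *)
Lemma is_derive_critical_weight_line (n tau r b t0 p s : R) :
  2 <= n -> 0 < tau -> 0 < r -> 0 <= b ->
  is_derive
    (fun t => critical_weight n tau (r + p * (t - t0)) (b + s * (t - t0))) t0
    (p * critical_weight_dr n tau r b + s * critical_weight_db n tau r b).
Proof.
intros hn ht hr hb.
unfold critical_weight, critical_weight_dr, critical_weight_db, critical_slope.
assert (hA : 0 < n * b + tau) by nra.
auto_derive.
- replace (t0 + - t0) with 0 by ring; rewrite !Rmult_0_r, !Rplus_0_r.
  assert (0 < (n * b + tau) ^ 2) by (apply pow_lt; lra).
  assert (0 < r ^ 2) by (apply pow_lt; lra).
  repeat split; try lra.
  apply Rgt_not_eq; repeat apply Rmult_lt_0_compat; simpl in *; lra.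
- replace (t0 + - t0) with 0 by ring; rewrite !Rmult_0_r, !Rplus_0_r.
  field; repeat split; lra.
Qed.

Lemma is_derive_critical_weight (n tau r b : R) :
  2 <= n -> 0 < tau -> 0 < r -> 0 <= b ->
  is_derive (critical_weight n tau r) b (critical_weight_db n tau r b).
Proof.
intros hn ht hr hb.
assert (h := is_derive_critical_weight_line n tau r b b 0 1 hn ht hr hb).
rewrite Rmult_0_l, Rmult_1_l, Rplus_0_l in h.
eapply is_derive_ext; [|exact h].
intros t; simpl; f_equal; ring.
Qed.

(** * Strict quasiconvexity of the critical weight in [b] *)

Lemma critical_slope_increasing (n tau r b c : R) :
  2 <= n -> 0 < tau -> 0 < r -> 0 <= b -> b < c -> c <= r ->
  0 <= critical_slope n tau r b -> 0 < critical_slope n tau r c.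
Proof.
intros hn ht hr hb hbc hc; unfold critical_slope.
(* With [d = r - c] and [e = c - b], passing from [b] to [c] lowers [d + e] to [d] and raises [B] to
   [C = B + (n - 1) * e]; the two changes are treated in turn. *)
set (B := (n - 1) * b + r + tau).
replace ((n - 1) * c + r + tau) with (B + (n - 1) * (c - b)) by (unfold B; ring).
replace (r - b) with ((r - c) + (c - b)) by ring.
assert (hB : 0 < B) by (unfold B; nra).
generalize dependent B; intros B hB.
assert (he : 0 < c - b) by lra; assert (hd : 0 <= r - c) by lra.
set (e := c - b) in *; set (d := r - c) in *; clearbody e d.
clear b c hb hbc hc.
set (C := B + (n - 1) * e).
assert (hC : B < C) by (unfold C; nra).
clearbody C; intros h.
assert (hM : 0 < n - 1) by lra.
set (M := n - 1) in *.
assert (hd3 : 0 < (d + e) ^ 3 - d ^ 3).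
{ replace ((d + e) ^ 3 - d ^ 3) with (e * (3 * d ^ 2 + 3 * d * e + e ^ 2)) by ring.
  apply Rmult_lt_0_compat; [lra|]. nra. }
assert (h' : 0 < (n - 2) * B ^ 3 - 3 * M * B ^ 2 * d - M ^ 2 * d ^ 3).
{ assert (0 < M * B ^ 2 * e) by (repeat apply Rmult_lt_0_compat; try apply pow_lt; lra).
  assert (0 < M ^ 2 * ((d + e) ^ 3 - d ^ 3))
    by (repeat apply Rmult_lt_0_compat; try apply pow_lt; lra).
  nra. }
(* [d + e] is already lowered to [d]; what remains is that the cubic divided
   by the cube of [B] increases when [B] grows to [C]. *)
assert (hx : (n - 2) * C ^ 3 - 3 * M * C ^ 2 * d - M ^ 2 * d ^ 3
   = (C / B) ^ 3 * ((n - 2) * B ^ 3 - 3 * M * B ^ 2 * d - M ^ 2 * d ^ 3)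
     + 3 * M * d * C ^ 2 * (C / B - 1)
     + M ^ 2 * d ^ 3 * ((C / B) ^ 3 - 1)) by (field; lra).
rewrite hx.
assert (hq : 1 < C / B) by (apply (Rmult_lt_reg_r B); [lra|]; field_simplify; lra).
set (q := C / B) in *.
assert (hq3 : 1 < q ^ 3) by (simpl; nra).
assert (0 < q ^ 3 * ((n - 2) * B ^ 3 - 3 * M * B ^ 2 * d - M ^ 2 * d ^ 3))
  by (apply Rmult_lt_0_compat; lra).
assert (0 <= 3 * M * d * C ^ 2 * (q - 1)).
{ repeat apply Rmult_le_pos; try lra. }
assert (0 <= M ^ 2 * d ^ 3 * (q ^ 3 - 1)).
{ repeat apply Rmult_le_pos; try apply pow_le; lra. }
lra.
Qed.

Lemma critical_weight_db_pos (n tau r b : R) :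
  2 <= n -> 0 < tau -> 0 < r -> 0 <= b ->
  0 < critical_slope n tau r b -> 0 < critical_weight_db n tau r b.
Proof.
intros hn ht hr hb hg; unfold critical_weight_db.
assert (hA : 0 < n * b + tau) by nra.
assert (hB : 0 < (n - 1) * b + r + tau) by nra.
apply Rdiv_lt_0_compat; repeat apply Rmult_lt_0_compat; try apply pow_lt; lra.
Qed.

Lemma critical_weight_db_neg (n tau r b : R) :
  2 <= n -> 0 < tau -> 0 < r -> 0 <= b ->
  critical_slope n tau r b < 0 -> critical_weight_db n tau r b < 0.
Proof.
intros hn ht hr hb hg; unfold critical_weight_db.
assert (hA : 0 < n * b + tau) by nra.
assert (hB : 0 < (n - 1) * b + r + tau) by nra.
assert (h : 0 < 2 * ((n - 1) * b + r + tau) * (- critical_slope n tau r b)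
                / ((n - 1) * (n * b + tau) ^ 3 * r ^ 2)).
{ apply Rdiv_lt_0_compat; repeat apply Rmult_lt_0_compat; try apply pow_lt; lra. }
unfold Rdiv in *; lra.
Qed.

(** By [critical_slope_increasing], a slope that is nonpositive at [b] is negative at every earlier
    point; the mean value theorem concludes. *)
Lemma critical_weight_decreasing (n tau r a b : R) :
  2 <= n -> 0 < tau -> 0 < r -> 0 <= a -> a < b -> b <= r ->
  critical_slope n tau r b <= 0 ->
  critical_weight n tau r b < critical_weight n tau r a.
Proof.
intros hn ht hr ha hab hb hg.
destruct (MVT_cor2 (critical_weight n tau r) (critical_weight_db n tau r) a b hab)
  as [c [hc hcab]].
{ intros c hc; apply is_derive_Reals, is_derive_critical_weight; lra. }
assert (hneg : critical_weight_db n tau r c < 0).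
{ apply critical_weight_db_neg; try lra.
  apply Rnot_le_lt; intros hge.
  generalize (critical_slope_increasing n tau r c b); lra. }
nra.
Qed.

Lemma critical_weight_increasing (n tau r b c : R) :
  2 <= n -> 0 < tau -> 0 < r -> 0 <= b -> b < c -> c <= r ->
  0 <= critical_slope n tau r b ->
  critical_weight n tau r b < critical_weight n tau r c.
Proof.
intros hn ht hr hb hbc hc hg.
destruct (MVT_cor2 (critical_weight n tau r) (critical_weight_db n tau r) b c hbc)
  as [x [hx hxbc]].
{ intros x hx; apply is_derive_Reals, is_derive_critical_weight; lra. }
assert (hpos : 0 < critical_weight_db n tau r x).
{ apply critical_weight_db_pos; try lra.
  apply (critical_slope_increasing n tau r b x); lra. }
nra.
Qed.

(** According to the sign of the slope at [b], the value there is strictly below the one at [a] or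
    the one at [c]. *)
Lemma critical_weight_quasiconvex (n tau r a b c L : R) :
  2 <= n -> 0 < tau -> 0 < r -> 0 <= a -> a < b -> b < c -> c <= r ->
  critical_weight n tau r a <= L -> critical_weight n tau r c <= L ->
  critical_weight n tau r b < L.
Proof.
intros hn ht hr ha hab hbc hc h1 h2.
destruct (Rle_lt_dec (critical_slope n tau r b) 0) as [hg|hg].
- generalize (critical_weight_decreasing n tau r a b); lra.
- generalize (critical_weight_increasing n tau r b c); lra.
Qed.

(** * Signs of the partial derivatives at a crossing *)

Lemma critical_slope_pos_at_crossing (n tau r b : R) :
  2 <= n -> 0 < tau -> 0 < r -> 0 < b <= r ->
  critical_weight n tau r 0 < critical_weight n tau r b ->
  0 < critical_slope n tau r b.
Proof.
intros hn ht hr hb h.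
apply Rnot_le_lt; intros hg.
generalize (critical_weight_decreasing n tau r 0 b); lra.
Qed.

Lemma critical_weight_dr_nonpos (n tau r b : R) :
  2 <= n -> 0 < tau -> 0 < r -> 0 <= b <= r ->
  0 <= critical_slope n tau r b -> critical_weight_dr n tau r b <= 0.
Proof.
intros hn ht hr hb; unfold critical_weight_dr, critical_slope.
set (B := (n - 1) * b + r + tau); set (d := r - b).
assert (hB : 0 < B) by (unfold B; nra).
assert (hA : 0 < n * b + tau) by nra.
intros hg.
replace ((n - 1) * b + tau) with (B - r) by (unfold B; ring).
(* The numerator is affine and increasing in [r] for fixed [B] and [d]; at
   [r = (B + (n - 1) * d) / n] it equals [- critical_slope / n]. *)
assert (hrB : n * r <= B + (n - 1) * d) by (unfold B, d; nra).
assert (hd : 0 <= d) by (unfold d; lra).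
assert (hQ : r * B * (B + (n - 1) * d) - (B - r) * (B ^ 2 + (n - 1) * d ^ 2) <= 0).
{ apply (Rmult_le_reg_l n); [lra|].
  replace (n * (r * B * (B + (n - 1) * d) - (B - r) * (B ^ 2 + (n - 1) * d ^ 2)))
    with (n * r * (B * (B + (n - 1) * d) + (B ^ 2 + (n - 1) * d ^ 2))
          - n * B * (B ^ 2 + (n - 1) * d ^ 2)) by ring.
  assert (hp : 0 <= B * (B + (n - 1) * d) + (B ^ 2 + (n - 1) * d ^ 2)).
  { assert (0 <= (n - 1) * d) by nra.
    assert (0 <= (n - 1) * d ^ 2) by nra.
    nra. }
  apply Rmult_le_compat_r with (r := B * (B + (n - 1) * d) + (B ^ 2 + (n - 1) * d ^ 2))
    in hrB; [|exact hp].
  nra. }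
clearbody B d.
assert (h : 0 <= 2 * B *
   (- (r * B * (B + (n - 1) * d) - (B - r) * (B ^ 2 + (n - 1) * d ^ 2)))
   / ((n - 1) * (n * b + tau) ^ 2 * r ^ 3)).
{ apply Rmult_le_pos; [repeat apply Rmult_le_pos; lra|].
  apply Rlt_le, Rinv_0_lt_compat; repeat apply Rmult_lt_0_compat;
    try apply pow_lt; lra. }
unfold Rdiv in *; lra.
Qed.

(** * Endpoint thresholds and location of the maximizer *)

Lemma critical_weight_0 (n tau r : R) :
  2 <= n -> 0 < tau -> 0 < r ->
  critical_weight n tau r 0
  = (n * r ^ 2 + 2 * r * tau + tau ^ 2) * (r + tau) ^ 2
      / ((n - 1) * r ^ 2 * tau ^ 2).
Proof. intros hn ht hr; unfold critical_weight; field; repeat split; lra. Qed.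

Lemma critical_weight_r (n tau r : R) :
  2 <= n -> 0 < tau -> 0 < r ->
  critical_weight n tau r r = (n * r + tau) ^ 2 / ((n - 1) * r ^ 2).
Proof.
intros hn ht hr; unfold critical_weight.
assert (0 < n * r + tau) by nra.
field; repeat split; lra.
Qed.

(** Points violating the participation constraint have utility below [utility_alone], hence below
    that of [m]; so [m] is an unconstrained maximizer on the interval. *)
Lemma maximizer_interval (N : nat) (tau r lam m : R) :
  is_maximizer N tau r lam m ->
  0 <= m <= r /\
  forall b, 0 <= b <= r -> utility N tau r lam b <= utility N tau r lam m.
Proof.
intros [[hm hu] hmax]; split; [exact hm|intros b hb].
destruct (Rle_lt_dec (utility_alone tau r lam) (utility N tau r lam b)) as [h|h].
- apply hmax; split; [exact hb|lra].
- lra.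
Qed.

(** The utility has positive derivative at [0], so a maximizer located there would have to be the
    right endpoint. *)
Lemma maximizer_pos (N : nat) (tau r lam m : R) :
  2 <= INR N -> 0 < tau -> 0 < r -> is_maximizer N tau r lam m ->
  critical_weight (INR N) tau r 0 < lam -> 0 < m.
Proof.
intros hN ht hr hmax h0.
destruct (maximizer_interval _ _ _ _ _ hmax) as [hm hle].
destruct (Req_dec m 0) as [e|]; [|lra].
enough (m = r) by lra.
apply (argmax_derive_pos _ 0 r m _ hm hle
         (is_derive_utility N tau r lam m hN ht hr ltac:(lra))).
rewrite e; apply Rmult_lt_0_compat; [|lra].
apply Rdiv_lt_0_compat; [lra|apply pow_lt; lra].
Qed.

(** Both endpoint values of the critical weight are at most [lam], so quasiconvexity makes the
    derivative positive at every interior point. *)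
Lemma maximizer_no_noise (N : nat) (tau r lam m : R) :
  2 <= INR N -> 0 < tau -> 0 < r -> is_maximizer N tau r lam m ->
  critical_weight (INR N) tau r 0 < lam ->
  critical_weight (INR N) tau r r <= lam -> m = r.
Proof.
intros hN ht hr hmax h0 h1.
assert (hpos := maximizer_pos N tau r lam m hN ht hr hmax h0).
destruct (maximizer_interval _ _ _ _ _ hmax) as [hm hle].
destruct (Req_dec m r) as [|hne]; [assumption|].
apply (argmax_derive_pos _ 0 r m _ hm hle
         (is_derive_utility N tau r lam m hN ht hr ltac:(lra))).
assert (hlt := critical_weight_quasiconvex (INR N) tau r 0 m r lam
   ltac:(lra) ht hr ltac:(lra) hpos ltac:(lra) ltac:(lra) ltac:(lra) h1).
apply Rmult_lt_0_compat; [|lra].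
apply Rdiv_lt_0_compat; [lra|apply pow_lt; nra].
Qed.

(** A nonzero derivative at [m] would force [m] to an endpoint; [h1] excludes [r] and
    [maximizer_pos] excludes [0]. *)
Lemma maximizer_critical (N : nat) (tau r lam m : R) :
  2 <= INR N -> 0 < tau -> 0 < r -> is_maximizer N tau r lam m ->
  critical_weight (INR N) tau r 0 < lam ->
  lam < critical_weight (INR N) tau r r ->
  0 < m < r /\ critical_weight (INR N) tau r m = lam.
Proof.
intros hN ht hr hmax h0 h1.
assert (hpos := maximizer_pos N tau r lam m hN ht hr hmax h0).
destruct (maximizer_interval _ _ _ _ _ hmax) as [hm hle].
assert (hd := is_derive_utility N tau r lam m hN ht hr ltac:(lra)).
assert (hc : 0 < (INR N - 1) / ((INR N - 1) * m + r + tau) ^ 2)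
  by (apply Rdiv_lt_0_compat; [lra|apply pow_lt; nra]).
assert (hge : lam <= critical_weight (INR N) tau r m).
{ apply Rnot_lt_le; intros hlt.
  assert (e : m = r) by (apply (argmax_derive_pos _ 0 r m _ hm hle hd); nra).
  rewrite e in hlt; lra. }
assert (hle' : critical_weight (INR N) tau r m <= lam).
{ apply Rnot_lt_le; intros hlt.
  assert (m = 0) by (apply (argmax_derive_neg _ 0 r m _ hm hle hd); nra).
  lra. }
assert (m <> r) by (intros e; rewrite e in hle'; lra).
split; lra.
Qed.

(** Quasiconvexity on [0 < z < m], and its contrapositive on [0 < m < z]. This yields both the
    uniqueness of the critical point and the sign hypothesis of [is_derive_implicit]. *)
Lemma critical_weight_sign (n tau r lam m z : R) :
  2 <= n -> 0 < tau -> 0 < r -> 0 < m <= r ->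
  critical_weight n tau r 0 < lam -> critical_weight n tau r m = lam ->
  0 <= z <= r ->
  (z < m -> critical_weight n tau r z < lam) /\
  (m < z -> lam < critical_weight n tau r z).
Proof.
intros hn ht hr hm h0 hc hz; split; intros hlt.
- destruct (Req_dec z 0) as [->|]; [exact h0|].
  apply (critical_weight_quasiconvex n tau r 0 z m lam); lra.
- apply Rnot_le_lt; intros hle.
  generalize (critical_weight_quasiconvex n tau r 0 m z lam); lra.
Qed.

(** * Unprofitable collaboration at a small accuracy weight *)

Lemma utility_lt_alone (N : nat) (tau r lam b : R) :
  2 <= INR N -> 0 < tau -> 0 < r -> 0 < b <= r ->
  lam < (INR N * r + tau) ^ 2 / ((INR N - 1) ^ 2 * r ^ 2) ->
  utility N tau r lam b < utility_alone tau r lam.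
Proof.
intros hN ht hr hb; unfold utility, utility_alone.
generalize dependent (INR N); intros n hn hlam.
assert (hA : 0 < n * b + tau) by nra.
assert (hB : 0 < (n - 1) * b + r + tau) by nra.
apply Rlt_0_minus.
(* The loss against training alone is a positive multiple of a rational function of [b] minus
   [lam]. *)
replace (- (lam / (r + tau)) - ((r - b) * ((n - 1) * b + r + tau)
     / ((n * b + tau) * r ^ 2) - 1 / r - 1 / tau - lam / ((n - 1) * b + r + tau)))
  with (b * (n - 1) / (((n - 1) * b + r + tau) * (r + tau))
    * ((n * r ^ 2 + 2 * r * tau + tau ^ 2 + tau * (n - 1) * b)
         * ((n - 1) * b + r + tau) * (r + tau)
         / ((n - 1) * tau * (n * b + tau) * r ^ 2) - lam))
  by (field; repeat split; lra).
apply Rmult_lt_0_compat.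
{ apply Rdiv_lt_0_compat; repeat apply Rmult_lt_0_compat; lra. }
(* As [lam] is strictly below the threshold, a weak comparison of the threshold with that function
   suffices. *)
enough (0 <= (n * r ^ 2 + 2 * r * tau + tau ^ 2 + tau * (n - 1) * b)
     * ((n - 1) * b + r + tau) * (r + tau) / ((n - 1) * tau * (n * b + tau) * r ^ 2)
   - (n * r + tau) ^ 2 / ((n - 1) ^ 2 * r ^ 2)) by lra.
replace ((n * r ^ 2 + 2 * r * tau + tau ^ 2 + tau * (n - 1) * b)
     * ((n - 1) * b + r + tau) * (r + tau) / ((n - 1) * tau * (n * b + tau) * r ^ 2)
   - (n * r + tau) ^ 2 / ((n - 1) ^ 2 * r ^ 2))
  with (((n - 1) * (n * r ^ 2 + 2 * r * tau + tau ^ 2 + tau * (n - 1) * b)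
     * ((n - 1) * b + r + tau) * (r + tau) - tau * (n * b + tau) * (n * r + tau) ^ 2)
     / ((n - 1) ^ 2 * tau * (n * b + tau) * r ^ 2))
  by (field; repeat split; lra).
apply Rmult_le_pos.
2:{ apply Rlt_le, Rinv_0_lt_compat; repeat apply Rmult_lt_0_compat;
    try apply pow_lt; lra. }
(* With [n = m + 2] and [r = b + d] every coefficient is nonnegative. *)
replace r with (b + (r - b)) by ring; replace n with (n - 2 + 2) by ring.
assert (hm : 0 <= n - 2) by lra; assert (hd : 0 <= r - b) by lra.
set (m := n - 2) in *; set (d := r - b) in *; clearbody m d.
ring_simplify.
repeat apply Rplus_le_le_0_compat;
  repeat (apply Rmult_le_pos || apply pow_le); lra.
Qed.

Lemma maximizer_zero (N : nat) (tau r lam m : R) :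
  2 <= INR N -> 0 < tau -> 0 < r -> is_maximizer N tau r lam m ->
  lam < (INR N * r + tau) ^ 2 / ((INR N - 1) ^ 2 * r ^ 2) -> m = 0.
Proof.
intros hN ht hr [[hm hu] _] hlam.
destruct (Req_dec m 0) as [|hne]; [assumption|exfalso].
generalize (utility_lt_alone N tau r lam m hN ht hr ltac:(lra) hlam); lra.
Qed.

(** * Uniqueness of the critical point, and dependence of the maximizer on the parameters *)

Lemma critical_point_unique (N : nat) (tau r lam m b : R) :
  2 <= INR N -> 0 < tau -> 0 < r -> is_maximizer N tau r lam m ->
  critical_weight (INR N) tau r 0 < lam ->
  lam < critical_weight (INR N) tau r r ->
  0 <= b <= r -> is_derive (utility N tau r lam) b 0 <-> b = m.
Proof.
intros hN ht hr hmax h0 h1 hb.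
destruct (maximizer_critical N tau r lam m hN ht hr hmax h0 h1) as [hm hc].
assert (hd := is_derive_utility N tau r lam b hN ht hr ltac:(lra)).
assert (hpos : 0 < (INR N - 1) / ((INR N - 1) * b + r + tau) ^ 2)
  by (apply Rdiv_lt_0_compat; [lra|apply pow_lt; nra]).
split; intros h.
- assert (e := is_derive_unique _ _ _ hd).
  rewrite (is_derive_unique _ _ _ h) in e.
  destruct (critical_weight_sign (INR N) tau r lam m b) as [h2 h3]; try lra.
  assert (hw : lam - critical_weight (INR N) tau r b = 0)
    by (symmetry in e; apply Rmult_integral in e; lra).
  destruct (Rtotal_order b m) as [hlt|[|hlt]]; [|assumption|].
  + specialize (h2 hlt); lra.
  + specialize (h3 hlt); lra.
- subst b; rewrite hc, Rminus_diag, Rmult_0_r in hd; exact hd.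
Qed.

(** Implicit differentiation of [critical_weight = lam], whose partial derivative in [lam] is [-1]
    once [lam] is moved to the left. No regularity of the selection [f] is assumed. *)
Lemma is_derive_maximizer_lam (N : nat) (tau r lam : R) (f : R -> R) :
  2 <= INR N -> 0 < tau -> 0 < r -> 0 < lam ->
  (forall l, 0 < l -> is_maximizer N tau r l (f l)) ->
  critical_weight (INR N) tau r 0 < lam ->
  lam < critical_weight (INR N) tau r r ->
  is_derive f lam (/ critical_weight_db (INR N) tau r (f lam)).
Proof.
intros hN ht hr hl hf h0 h1.
destruct (maximizer_critical N tau r lam (f lam) hN ht hr (hf lam hl) h0 h1)
  as [hm hc].
assert (hg := critical_slope_pos_at_crossing (INR N) tau r (f lam) hN ht hr
                ltac:(lra) ltac:(lra)).
replace (/ critical_weight_db (INR N) tau r (f lam))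
  with (- (-1) / critical_weight_db (INR N) tau r (f lam)) by (unfold Rdiv; ring).
apply (is_derive_implicit (fun t z => critical_weight (INR N) tau r z - t)).
- apply critical_weight_db_pos; lra.
- lra.
- intros s.
  assert (hd := is_derive_critical_weight_line (INR N) tau r (f lam) lam 0 s
                  hN ht hr ltac:(lra)).
  replace (-1 + s * critical_weight_db (INR N) tau r (f lam))
    with (0 * critical_weight_dr (INR N) tau r (f lam)
          + s * critical_weight_db (INR N) tau r (f lam) - 1) by ring.
  apply (is_derive_minus (fun t => critical_weight (INR N) tau r (f lam + s * (t - lam)))
           (fun t => t)).
  + eapply is_derive_ext; [|exact hd].
    intros t; simpl; rewrite Rmult_0_l, Rplus_0_r; reflexivity.
  + apply (is_derive_id (K := R_AbsRing)).
(* The strict threshold inequalities persist near [lam], so [f t] still solves the critical equation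
   there. *)
- assert (hnear : locally lam (fun t => 0 < t
      /\ critical_weight (INR N) tau r 0 < t
      /\ t < critical_weight (INR N) tau r r)).
  { repeat apply filter_and.
    - apply (open_gt 0 lam hl).
    - apply (open_gt _ lam h0).
    - apply (open_lt _ lam h1). }
  destruct hnear as [e he].
  exists (Rmin e (Rmin (f lam) (r - f lam))); split.
  { repeat apply Rmin_pos; try lra; apply cond_pos. }
  intros t z htl hz.
  assert (m1 := Rmin_l e (Rmin (f lam) (r - f lam))).
  assert (m2 := Rmin_r e (Rmin (f lam) (r - f lam))).
  assert (m3 := Rmin_l (f lam) (r - f lam)).
  assert (m4 := Rmin_r (f lam) (r - f lam)).
  destruct (he t (Rlt_le_trans _ _ _ htl m1)) as [t0 [t1 t2]].
  apply Rabs_def2 in hz.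
  destruct (maximizer_critical N tau r t (f t) hN ht hr (hf t t0) t1 t2) as [k1 k2].
  destruct (critical_weight_sign (INR N) tau r t (f t) z) as [k3 k4]; lra.
Qed.

Lemma is_derive_maximizer_rho (N : nat) (tau r lam : R) (f : R -> R) :
  2 <= INR N -> 0 < tau -> 0 < r ->
  (forall t, 0 < t -> is_maximizer N tau t lam (f t)) ->
  critical_weight (INR N) tau r 0 < lam ->
  lam < critical_weight (INR N) tau r r ->
  is_derive f r (- critical_weight_dr (INR N) tau r (f r)
                   / critical_weight_db (INR N) tau r (f r)).
Proof.
intros hN ht hr hf h0 h1.
destruct (maximizer_critical N tau r lam (f r) hN ht hr (hf r hr) h0 h1)
  as [hm hc].
assert (hg := critical_slope_pos_at_crossing (INR N) tau r (f r) hN ht hr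
                ltac:(lra) ltac:(lra)).
assert (hline : forall b s, 0 <= b ->
  is_derive (fun t => critical_weight (INR N) tau t (b + s * (t - r))) r
    (critical_weight_dr (INR N) tau r b + s * critical_weight_db (INR N) tau r b)).
{ intros b s hb.
  assert (hd := is_derive_critical_weight_line (INR N) tau r b r 1 s hN ht hr hb).
  rewrite Rmult_1_l in hd.
  eapply is_derive_ext; [|exact hd].
  intros t; simpl; f_equal; ring. }
apply (is_derive_implicit (fun t z => critical_weight (INR N) tau t z - lam)).
- apply critical_weight_db_pos; lra.
- lra.
- intros s.
  assert (hd := hline (f r) s ltac:(lra)).
  replace (critical_weight_dr (INR N) tau r (f r)
            + s * critical_weight_db (INR N) tau r (f r))
    with (critical_weight_dr (INR N) tau r (f r)
            + s * critical_weight_db (INR N) tau r (f r) - 0) by ring.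
  apply (is_derive_minus
           (fun t => critical_weight (INR N) tau t (f r + s * (t - r)))
           (fun _ => lam)).
  + exact hd.
  + apply (is_derive_const (K := R_AbsRing) (V := R_NormedModule)).
(* Here the thresholds move with [t]; their continuity follows from [hline] along [b = 0] and along
   the diagonal. *)
- assert (hnear : locally r (fun t => 0 < t
      /\ critical_weight (INR N) tau t 0 < lam
      /\ lam < critical_weight (INR N) tau t t)).
  { repeat apply filter_and.
    - apply (open_gt 0 r hr).
    - assert (hct : continuous (fun t => critical_weight (INR N) tau t 0) r).
      { apply (ex_derive_continuous (fun t => critical_weight (INR N) tau t 0)).
        eexists; eapply is_derive_ext; [|apply (hline 0 0); lra].
        intros t; simpl; f_equal; ring. }
      exact (hct _ (open_lt lam _ h0)).
    - assert (hct : continuous (fun t => critical_weight (INR N) tau t t) r).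
      { apply (ex_derive_continuous (fun t => critical_weight (INR N) tau t t)).
        eexists; eapply is_derive_ext; [|apply (hline r 1); lra].
        intros t; simpl; f_equal; ring. }
      exact (hct _ (open_gt lam _ h1)). }
  destruct hnear as [e he].
  (* The interval [[0, t]] moves too: half the gap keeps [z] below [(r + f r) / 2] and [t] above it,
     so [z < t]. *)
  exists (Rmin e (Rmin (f r) ((r - f r) / 2))); split.
  { repeat apply Rmin_pos; try lra; apply cond_pos. }
  intros t z htr hz.
  assert (m1 := Rmin_l e (Rmin (f r) ((r - f r) / 2))).
  assert (m2 := Rmin_r e (Rmin (f r) ((r - f r) / 2))).
  assert (m3 := Rmin_l (f r) ((r - f r) / 2)).
  assert (m4 := Rmin_r (f r) ((r - f r) / 2)).
  destruct (he t (Rlt_le_trans _ _ _ htr m1)) as [t0 [t1 t2]].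
  apply Rabs_def2 in hz; apply Rabs_def2 in htr.
  destruct (maximizer_critical N tau t lam (f t) hN ht t0 (hf t t0) t1 t2) as [k1 k2].
  destruct (critical_weight_sign (INR N) tau t lam (f t) z) as [k3 k4]; lra.
Qed.

(** * Assembly of the three regimes *)

Theorem mainTheorem6 (N : nat) (tau : R) (hN : (2 <= N)%nat) (htau : 0 < tau)
  (betastar : R -> R -> R)
  (hbetastar : forall rho lam : R, 0 < rho -> 0 < lam ->
     is_maximizer N tau rho lam (betastar rho lam))
  (rho lam : R) (hrho : 0 < rho) (hlam : 0 < lam) :
  (lam < (INR N * rho + tau) ^ 2 / ((INR N - 1) ^ 2 * rho ^ 2) ->
     betastar rho lam = 0)
  /\
  (lam > (INR N * rho ^ 2 + 2 * rho * tau + tau ^ 2) * (rho + tau) ^ 2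
           / ((INR N - 1) * rho ^ 2 * tau ^ 2) ->
     betastar rho lam > 0 /\
     (lam < (INR N * rho + tau) ^ 2 / ((INR N - 1) * rho ^ 2) ->
        (forall b : R, 0 <= b <= rho ->
           (is_derive (utility N tau rho lam) b 0 <-> b = betastar rho lam)) /\
        (ex_derive (fun l : R => betastar rho l) lam /\
         Derive (fun l : R => betastar rho l) lam >= 0) /\
        (ex_derive (fun r : R => betastar r lam) rho /\
         Derive (fun r : R => betastar r lam) rho >= 0)))
  /\
  (lam > (INR N * rho ^ 2 + 2 * rho * tau + tau ^ 2) * (rho + tau) ^ 2
           / ((INR N - 1) * rho ^ 2 * tau ^ 2) ->
   lam >= (INR N * rho + tau) ^ 2 / ((INR N - 1) * rho ^ 2) ->
     betastar rho lam > 0 /\ betastar rho lam = rho).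
Proof.
assert (hNR : 2 <= INR N) by (apply (le_INR 2); exact hN).
assert (hmax := hbetastar rho lam hrho hlam).
(* The thresholds of parts (2) and (3) become endpoint values of the critical weight. *)
rewrite <- critical_weight_0, <- critical_weight_r by assumption.
split; [|split].
- exact (maximizer_zero N tau rho lam _ hNR htau hrho hmax).
- intros h0; split; [exact (maximizer_pos N tau rho lam _ hNR htau hrho hmax h0)|].
  intros h1.
  destruct (maximizer_critical N tau rho lam _ hNR htau hrho hmax h0 h1) as [hm hc].
  assert (hg := critical_slope_pos_at_crossing (INR N) tau rho (betastar rho lam)
                  hNR htau hrho ltac:(lra) ltac:(lra)).
  assert (hdb := critical_weight_db_pos (INR N) tau rho (betastar rho lam)
                   hNR htau hrho ltac:(lra) hg).
  split; [|split].
  + intros b hb; apply critical_point_unique; assumption.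
  + assert (hd := is_derive_maximizer_lam N tau rho lam (fun l => betastar rho l)
                    hNR htau hrho hlam (fun l hl => hbetastar rho l hrho hl) h0 h1).
    split; [eexists; exact hd|].
    rewrite (is_derive_unique _ _ _ hd).
    apply Rle_ge, Rlt_le, Rinv_0_lt_compat, hdb.
  + assert (hd := is_derive_maximizer_rho N tau rho lam (fun r => betastar r lam)
                    hNR htau hrho (fun r hr => hbetastar r lam hr hlam) h0 h1).
    split; [eexists; exact hd|].
    rewrite (is_derive_unique _ _ _ hd).
    assert (hdr := critical_weight_dr_nonpos (INR N) tau rho (betastar rho lam)
                     hNR htau hrho ltac:(lra) ltac:(lra)).
    apply Rle_ge, Rmult_le_pos; [lra|].
    apply Rlt_le, Rinv_0_lt_compat, hdb.
- intros h0 h1; split.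
  + exact (maximizer_pos N tau rho lam _ hNR htau hrho hmax h0).
  + exact (maximizer_no_noise N tau rho lam _ hNR htau hrho hmax h0 ltac:(lra)).
Qed.
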